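(* Let $p$ be a prime power, let $m\in\mathbb{N}$, and let $\Theta(t)=t^{-1}\sum_{i\ge0}s_it^{-i}\in\mathbb{F}_p(\!(t^{-1})\!)$ be a quadratic irrational. Let $\mathbf{X}$ be a finite alphabet containing symbols $0$ and $A$, let $\zeta$ be a two-dimensional $[p,p]$-morphism on $\mathbf{X}$ for which $A$ is $\zeta$-prolongable, and let $\xi$ be a two-dimensional $[m,m]$-coding from $\mathbf{X}$ to $\{0,1\}$. Assume $\xi(0)$ is the $m\times m$ zero block, $\zeta(0)$ is the $p\times p$ block of $0$'s, and the profile of the number wall of $\Theta$ equals $\xi(\zeta^\infty(A))$. If $\lim_{k\to\infty}\frac{N_0(\zeta^k(A))}{p^{2k}}=1$, then for every $\varepsilon>0$, $\lim_{n\to\infty}d(\{k\in\mathbb{N}:e_{k,n}(\Theta(t))>1-\varepsilon\})=1$.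
   Context: A two-dimensional $[k,l]$-coding $\tau$ from alphabet $\Sigma$ to alphabet $\Delta$ assigns to each letter a $k\times l$ matrix over $\Delta$ and acts on a finite or infinite matrix of letters by replacing each letter with its block (blockwise substitution); it is a $[k,l]$-morphism if $\Delta=\Sigma$. A letter $A$ is $\zeta$-prolongable if the $(0,0)$ entry of $\zeta(A)$ is $A$; then $\zeta^\infty(A)=\lim_k\zeta^k(A)$ is an infinite matrix indexed by $\mathbb{N}_0\times\mathbb{N}_0$. $N_0(B)$ is the number of occurrences of the letter $0$ in a block $B$. Number wall: with $s_i=0$ for $i<0$, $W[m,n]=\det(s_{n-i+j})_{0\le i,j\le m}$ for $m\ge0$; its profile is the array indexed by $m,n\ge0$ with entry $0$ where $W[m,n]=0$ and $1$ otherwise. $e_{k,n}(\Theta):=\frac{\sum_{i=1}^{\ell_k}\max\{\deg A_i^{[\Theta t^k]}-n,0\}}{\sum_{i=1}^{\ell_k}\deg A_i^{[\Theta t^k]}}$, where $\ell_k$ is the period length of the eventually periodic continued fraction of $\Theta t^k$ and $A_1^{[\Theta t^k]},\dots,A_{\ell_k}^{[\Theta t^k]}$ its partial quotients over one period. For $S\subseteq\mathbb{N}$, $d(S)=\lim_{M\to\infty}|S\cap\{1,\dots,M\}|/M$. *)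

(* Defs.v *)
From HB Require Import structures.
From mathcomp Require Import all_boot all_order all_algebra all_field.
From mathcomp Require Import all_classical all_reals all_analysis.
Set Implicit Arguments.
Unset Strict Implicit.
Unset Printing Implicit Defensive.
Import Order.TTheory GRing.Theory Num.Theory.
Import numFieldNormedType.Exports.
Local Open Scope classical_set_scope.
Local Open Scope ring_scope.

(* Laurent series in t^{-1} over a field F: the formal series          *)
(*    sum_{i >= 0} lc i * t^(lval - i).                               *)
(* Two series are identified when all coefficients agree (leq_l).     *)
Record laur (F : fieldType) := Laur { lval : int ; lc : nat -> F }.

Section Laurent.
Variable F : fieldType.

Definition lcoef (x : laur F) (e : int) : F :=
  if (e <= lval x)%R then lc x `|lval x - e|%N else 0.

Definition leq_l (x y : laur F) : Prop := forall e : int, lcoef x e = lcoef y e.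

Definition ladd (x y : laur F) : laur F :=
  let V := Num.max (lval x) (lval y) in
  Laur V (fun n => lcoef x (V - n%:Z) + lcoef y (V - n%:Z)).

Definition lopp (x : laur F) : laur F := Laur (lval x) (fun n => - lc x n).

Definition lmul (x y : laur F) : laur F :=
  Laur (lval x + lval y) (fun n => \sum_(i < n.+1) lc x i * lc y (n - i)%N).

Definition lpoly (P : {poly F}) : laur F :=
  Laur (size P)%:Z (fun n => if (n <= size P)%N then P`_(size P - n) else 0).

Definition polypart (x : laur F) : {poly F} :=
  \poly_(i < `|lval x|.+1) lcoef x i%:Z.

Definition quad_irrational (x : laur F) : Prop :=
  (exists a b c : {poly F}, a != 0 /\
     leq_l (ladd (ladd (lmul (lpoly a) (lmul x x)) (lmul (lpoly b) x)) (lpoly c))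
           (lpoly 0))
  /\ ~ (exists P Q : {poly F}, Q != 0 /\ leq_l (lmul (lpoly Q) x) (lpoly P)).

Definition is_cf (x : laur F) (A : nat -> {poly F}) : Prop :=
  exists th : nat -> laur F,
    leq_l (th 0%N) x /\
    forall i, A i = polypart (th i) /\
              leq_l (lmul (ladd (th i) (lopp (lpoly (A i)))) (th i.+1)) (lpoly 1).

Definition is_period (A : nat -> {poly F}) (N l : nat) : Prop :=
  (0 < l)%N /\ forall i, (N <= i)%N -> A (i + l)%N = A i.

Definition min_period (A : nat -> {poly F}) (N l : nat) : Prop :=
  is_period A N l /\ forall N' l', is_period A N' l' -> (l <= l')%N.

Definition theta (s : nat -> F) : laur F := Laur (-1) s.

Definition sext (s : nat -> F) (z : int) : F :=
  match z with Posz k => s k | Negz _ => 0 end.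

Definition wall (s : nat -> F) (m n : nat) : F :=
  \det (\matrix_(i < m.+1, j < m.+1) sext s (n%:Z - (i : nat)%:Z + (j : nat)%:Z)).

End Laurent.

Definition eratio (R : realType) (F : fieldType) (A : nat -> {poly F}) (N l n : nat) : R :=
  (\sum_(N <= i < N + l) (((size (A i)).-1 - n)%N)%:R) /
  (\sum_(N <= i < N + l) ((size (A i)).-1)%:R).

Definition Eset (R : realType) (F : fieldType) (s : nat -> F) (eps : R) (n : nat)
  (k : nat) : Prop :=
  exists (A : nat -> {poly F}) (N l : nat),
    is_cf (lmul (theta s) (lpoly ('X ^+ k))) A /\ min_period A N l /\
    1 - eps < eratio R A N l n.

Definition dens_ratio (R : realType) (S : nat -> Prop) (M : nat) : R :=
  (#|[set k : 'I_M.+1 | (0 < (k : nat))%N && `[< S k >]]|)%:R / M%:R.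

Definition has_density (R : realType) (S : nat -> Prop) (d : R) : Prop :=
  (dens_ratio R S) @ \oo --> d.

Definition mget (T : Type) (n : nat) (M : 'M[T]_n) (d : T) (i j : nat) : T :=
  match (insub i : option 'I_n), (insub j : option 'I_n) with
  | Some a, Some b => M a b
  | _, _ => d
  end.

Fixpoint iter_blk (X : Type) (p : nat) (zeta : X -> 'M[X]_p) (zero : X)
  (k : nat) (A : X) (x y : nat) : X :=
  match k with
  | 0 => A
  | k'.+1 => mget (zeta (iter_blk zeta zero k' A (x %/ p) (y %/ p))) zero (x %% p) (y %% p)
  end.

(* entry (x,y) of zeta^oo(A) (A prolongable, p >= 2): = entry of zeta^k(A) for p^k > x,y *)
Definition zinf (X : Type) (p : nat) (zeta : X -> 'M[X]_p) (zero A : X) (x y : nat) : X :=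
  iter_blk zeta zero (x + y).+1 A x y.

Definition xi_zinf (X : Type) (p m : nat) (zeta : X -> 'M[X]_p) (xi : X -> 'M[bool]_m)
  (zero A : X) (x y : nat) : bool :=
  mget (xi (zinf zeta zero A (x %/ m) (y %/ m))) false (x %% m) (y %% m).

Definition N0 (X : finType) (p : nat) (zeta : X -> 'M[X]_p) (zero A : X) (k : nat) : nat :=
  #|[set xy : 'I_(p ^ k) * 'I_(p ^ k) |
      iter_blk zeta zero k A (xy.1 : nat) (xy.2 : nat) == zero]|.

(* Main.v *)
Require Import Defs.
From HB Require Import structures.
From mathcomp Require Import all_boot all_order all_algebra all_field.
From mathcomp Require Import all_classical all_reals all_analysis.
From mathcomp Require Import zify ring lra.
Import Order.TTheory GRing.Theory Num.Theory.
Import numFieldNormedType.Exports.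
Local Open Scope classical_set_scope.
Local Open Scope ring_scope.

(* Let D be the degree of a period of the continued fraction of Theta t^k, and l
   its length.  Since max(deg - n, 0) >= deg - n, the ratio e_{k,n} is at least
   1 - n l / D, so it suffices that l / D be small for almost every k.  A
   denominator of degree r of a convergent forces W[r-1, r-1+k] <> 0 (the
   determinant would otherwise provide a better approximation with a smaller
   denominator), so l / D is at most the density of non-zero entries on the
   k-th diagonal of the wall.

   Every letter B of zeta^oo(A) occurs in some zeta^j(A), so the proportion of
   non-zero letters in zeta^K(B) tends to 0, uniformly in B.  With L = m p^K, the
   strip of diagonals 0 <= k < L is covered by the blocks of size L at positions
   (I, I) and (I, I+1), hence has a small density of non-zero entries, and by
   Markov's inequality few diagonals k < L can have a large one.  The density is
   thus 1 for every n, not only in the limit. *)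

(* Power series in the variable 1/t. *)
Definition pser (F : fieldType) : Type := nat -> F.
HB.instance Definition _ (F : fieldType) := GRing.Zmodule.copy (pser F) (nat -> F).

Section PowerSeries.
Variable F : fieldType.
Implicit Types f g h : pser F.

Definition psmul f g : pser F := fun n => \sum_(i < n.+1) f i * g (n - i)%N.
Definition psconst (c : F) : pser F := fun n => c *+ (n == 0)%N.

Definition pstrunc (n : nat) f : {poly F} := \poly_(i < n.+1) f i.

Lemma coef_pstrunc n f i : (i <= n)%N -> (pstrunc n f)`_i = f i.
Proof. by move=> lein; rewrite coef_poly ltnS lein. Qed.

(** Coefficients up to n of a product only involve those of the factors up to n, so the ring laws
    are inherited from polynomials by truncation. *)
Lemma psmulE n f g k : (k <= n)%N ->
  psmul f g k = (pstrunc n f * pstrunc n g)`_k.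
Proof.
move=> lekn; rewrite coefM; apply: eq_bigr => i _.
by rewrite !coef_pstrunc //; have := ltn_ord i; lia.
Qed.

Lemma psmulC : commutative psmul.
Proof. by move=> f g; apply/funext => n; rewrite !(@psmulE n) // mulrC. Qed.

Lemma psmulA : associative psmul.
Proof.
move=> f g h; apply/funext => n.
transitivity ((pstrunc n f * (pstrunc n g * pstrunc n h))`_n).
  rewrite coefM; apply: eq_bigr => i _.
  by rewrite coef_pstrunc ?(@psmulE n) ?leq_subr // -ltnS.
rewrite mulrA coefM; apply: eq_bigr => i _.
by rewrite coef_pstrunc ?(@psmulE n) ?leq_subr // -ltnS.
Qed.

Lemma psconstM c f n : psmul (psconst c) f n = c * f n.
Proof.
rewrite /psmul big_ord_recl /psconst /= mulr1n subn0 big1 ?addr0 // => i _.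
by rewrite mulr0n mul0r.
Qed.

Lemma psmul1 : left_id (psconst 1) psmul.
Proof. by move=> f; apply/funext => n; rewrite psconstM mul1r. Qed.

Lemma psmulDl : left_distributive psmul +%R.
Proof.
move=> f g h; apply/funext => n; transitivity (psmul f h n + psmul g h n) => //.
by rewrite /psmul -big_split; apply: eq_bigr => i _ /=; rewrite -mulrDl.
Qed.

Lemma psone_neq0 : psconst 1 != 0.
Proof.
apply/eqP => /(congr1 (@^~ 0%N)); rewrite /psconst /= mulr1n => /eqP.
by rewrite oner_eq0.
Qed.

HB.instance Definition _ := GRing.Zmodule_isComNzRing.Build (pser F)
  psmulA psmulC psmul1 psmulDl psone_neq0.

(** Existence of an inverse, which [psinv] picks by choice; [ps_unit] shows later that a non-zero
    constant coefficient suffices. *)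
Definition psunit : pred (pser F) := fun f => `[< exists g, g * f = 1 >].
Definition psinv f : pser F := if psunit f then xget 0 [set g | g * f = 1] else f.

Lemma psmulV : {in psunit, left_inverse 1 psinv *%R}.
Proof.
move=> f uf; rewrite /psinv; have uf' : psunit f by [].
by rewrite uf'; case: xgetP => // /(_ _) nog; case/asboolP: uf' => g /nog.
Qed.

Lemma psunitP f g : g * f = 1 -> psunit f.
Proof. by move=> gf1; apply/asboolP; exists g. Qed.

Lemma psinv_out : {in [predC psunit], psinv =1 id}.
Proof. by move=> f /negbTE nuf; rewrite /psinv (nuf : psunit f = false). Qed.

HB.instance Definition _ := GRing.ComNzRing_hasMulInverse.Build (pser F)
  psmulV psunitP psinv_out.

Definition psX : pser F := fun n => (n == 1)%N%:R.

Lemma psMn f g n : (f * g) n = \sum_(i < n.+1) f i * g (n - i)%N.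
Proof. by []. Qed.

Lemma ps0n n : (0 : pser F) n = 0. Proof. by []. Qed.
Lemma ps1n n : (1 : pser F) n = (n == 0)%N%:R. Proof. by []. Qed.
Lemma psDn f g n : (f + g) n = f n + g n. Proof. by []. Qed.
Lemma psNn f n : (- f) n = - f n. Proof. by []. Qed.

Lemma pssumn (I : Type) (r : seq I) (P : pred I) (G : I -> pser F) n :
  (\sum_(i <- r | P i) G i) n = \sum_(i <- r | P i) G i n.
Proof. by elim/big_rec2: _ => // i x y _ <-. Qed.

Lemma psXM f n : (psX * f) n = if n is n'.+1 then f n' else 0.
Proof.
rewrite psMn; case: n => [|n]; first by rewrite big_ord1 /psX mul0r.
rewrite !big_ord_recl /psX /= mul0r add0r mul1r subSS subn0 big1 ?addr0 // => i _.
by rewrite mul0r.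
Qed.

Lemma psXnM k f n : (psX ^+ k * f) n = if (k <= n)%N then f (n - k)%N else 0.
Proof.
elim: k n => [|k IH] n; first by rewrite expr0 mul1r subn0.
rewrite exprS -mulrA psXM; case: n => [//|n]; rewrite IH ltnS subSS //.
Qed.

Lemma ps_shift k f : (forall n, (n < k)%N -> f n = 0) ->
  f = psX ^+ k * (fun n => f (n + k)%N : F).
Proof.
move=> f0; apply/funext => n; rewrite psXnM; case: leqP => [h|/f0 //].
by rewrite subnK.
Qed.

Lemma psX_factor f : f != 0 -> exists k g, g 0%N != 0 /\ f = psX ^+ k * g.
Proof.
move=> fN0; have exn : exists n, f n != 0.
  apply: contrapT => nex; move/negP: fN0; apply; apply/eqP/funext => n.
  by apply/eqP; apply: contrapT => fn; apply: nex; exists n; apply/negP.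
exists (ex_minn exn), (fun n => f (n + ex_minn exn)%N); case: ex_minnP => k fk mink.
split; first by rewrite add0n.
apply: ps_shift => n ltnk; apply/eqP; apply: contraTT ltnk => /mink; lia.
Qed.

Lemma psM0 f g : (f * g) 0%N = f 0%N * g 0%N.
Proof. by rewrite psMn big_ord1. Qed.

(** The product of the lowest non-zero coefficients is a coefficient of the product. *)
Lemma ps_integral f g : f * g = 0 -> (f == 0) || (g == 0).
Proof.
move=> fg0; apply/norP => -[/psX_factor[i [f' [f'0 Ef]]] /psX_factor[j [g' [g'0 Eg]]]].
have : (f * g) (i + j)%N = f' 0%N * g' 0%N.
  rewrite Ef Eg (_ : _ * _ = psX ^+ (i + j) * (f' * g')); last by rewrite exprD; ring.
  by rewrite psXnM leqnn subnn psM0.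
by rewrite fg0 => /esym/eqP; rewrite mulf_eq0 (negbTE f'0) (negbTE g'0).
Qed.

HB.instance Definition _ := GRing.ComUnitRing_isIntegral.Build (pser F) ps_integral.

Lemma psX_dvd_expr w n k : w 0%N = 0 -> (k < n)%N -> ((w : pser F) ^+ n) k = 0.
Proof.
move=> w0 ltkn; rewrite (_ : w = psX * (fun n => w n.+1)).
  by rewrite exprMn psXnM leqNgt ltkn.
by apply/funext => -[|i]; rewrite psXM.
Qed.

(* The inverse of a(1 - w) is a^-1 times the geometric series in w. *)
Lemma ps_unit f : f 0%N != 0 -> exists g, g 0%N != 0 /\ g * f = 1.
Proof.
move=> f0; pose w : pser F := 1 - psconst (f 0%N)^-1 * f.
have w0 : w 0%N = 0 by rewrite /w psDn psNn psM0 /psconst /= mulr1n mulVf // subrr.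
pose G n : pser F := \sum_(i < n.+1) w ^+ i.
(* The infinite series is read off its partial sums: as [w] has no constant term, [w ^+ i] does not
   touch the coefficients below i. *)
pose g : pser F := fun n => G n n.
have gE n k : (k <= n)%N -> g k = G n k.
  move=> lekn; rewrite /g /G !pssumn (big_ord_widen n.+1 (fun i => (w ^+ i) k)) // big_mkcond.
  apply: eq_bigr => i _; case: ltnP => // ltki.
  by rewrite psX_dvd_expr.
have gw : g * (1 - w) = 1.
  apply/funext => n; rewrite psMn.
  transitivity ((G n * (1 - w)) n).
    by rewrite psMn; apply: eq_bigr => i _; rewrite (gE n) // -ltnS.
  have -> : G n * (1 - w) = 1 - w ^+ n.+1.
    by rewrite -[1 in RHS](expr1n _ n.+1) subrXX mulrC; congr (_ * _); apply: eq_bigr => i _;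
       rewrite expr1n mul1r.
  by rewrite psDn psNn psX_dvd_expr // subr0.
exists (g * psconst (f 0%N)^-1); split.
  by rewrite psM0 /g /G big_ord1 expr0 ps1n /psconst /= mulr1n mul1r invr_eq0.
by rewrite -mulrA -[X in _ * X](_ : 1 - w = _) //; rewrite /w opprB addrC subrK.
Qed.

Lemma psconst_zmod : zmod_morphism psconst.
Proof. by move=> a b; apply/funext => n; rewrite /psconst mulrnBl. Qed.
Lemma psconst_monoid : monoid_morphism psconst.
Proof.
split=> // a b; apply/funext => n.
by rewrite [RHS]psconstM /psconst mulrnAr.
Qed.
HB.instance Definition _ := GRing.isZmodMorphism.Build F (pser F) psconst psconst_zmod.
HB.instance Definition _ := GRing.isMonoidMorphism.Build F (pser F) psconst psconst_monoid.

End PowerSeries.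

(** * Laurent series in 1/t as a fraction field, with the degree as valuation *)

Local Notation "x %:F" := (tofrac (R := pser _) x).

Section LaurentField.
Variable F : fieldType.
Local Notation K := {fraction (pser F)}.
Implicit Types (x y : K) (f g : pser F) (P : {poly F}).

(** The element 1/t. *)
Definition lsu : K := (psX F)%:F.
Local Notation u := lsu.

Lemma lsu_neq0 : u != 0.
Proof.
rewrite tofrac_eq0; apply/eqP => /(congr1 (@^~ 1%N)) /eqP.
by rewrite /psX ps0n oner_eq0.
Qed.

Lemma lsuXn n : u ^+ n = (psX F ^+ n)%:F.
Proof. by rewrite tofracXn. Qed.

Lemma lsuzD (a b : int) : u ^ (a + b) = u ^ a * u ^ b.
Proof. exact/expfzDr/lsu_neq0. Qed.

Lemma lsuz_neq0 (a : int) : u ^ a != 0.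
Proof. by rewrite expfz_neq0 ?lsu_neq0. Qed.

(* deg x <= e, respectively deg x = e. *)
Definition vle x (e : int) := exists f, x = u ^ (- e) * f%:F.
Definition vdeg x (e : int) := exists f, f 0%N != 0 /\ x = u ^ (- e) * f%:F.

Lemma vle_widen (a b : int) f : a <= b ->
  u ^ (- a) * f%:F = u ^ (- b) * (psX F ^+ `|b - a| * f)%:F.
Proof.
move=> leab; rewrite tofracM -lsuXn mulrA; congr (_ * _).
by rewrite exprnP -lsuzD; congr (_ ^ _); lia.
Qed.

Lemma vle_mono {x a} b : vle x a -> a <= b -> vle x b.
Proof. by move=> [f ->] leab; rewrite (vle_widen _ _ f leab); eexists. Qed.

Lemma vle0 e : vle 0 e.
Proof. by exists 0; rewrite tofrac0 mulr0. Qed.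

Lemma vleD x y e : vle x e -> vle y e -> vle (x + y) e.
Proof. by move=> [f ->] [g ->]; exists (f + g); rewrite tofracD mulrDr. Qed.

Lemma vleN x e : vle x e -> vle (- x) e.
Proof. by move=> [f ->]; exists (- f); rewrite tofracN mulrN. Qed.

Lemma vleB x y e : vle x e -> vle y e -> vle (x - y) e.
Proof. by move=> ? ?; apply: vleD => //; apply: vleN. Qed.

Lemma vleM x y a b : vle x a -> vle y b -> vle (x * y) (a + b).
Proof.
by move=> [f ->] [g ->]; exists (f * g); rewrite tofracM opprD lsuzD mulrACA.
Qed.

Lemma vdegW x e : vdeg x e -> vle x e.
Proof. by move=> [f [_ ->]]; exists f. Qed.

Lemma vdegM x y a b : vdeg x a -> vdeg y b -> vdeg (x * y) (a + b).
Proof.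
move=> [f [f0 ->]] [g [g0 ->]]; exists (f * g); rewrite psM0 mulf_neq0 //.
by rewrite tofracM opprD lsuzD mulrACA.
Qed.

Lemma vdegN x e : vdeg x e -> vdeg (- x) e.
Proof.
by move=> [f [f0 ->]]; exists (- f); rewrite psNn oppr_eq0 tofracN mulrN.
Qed.

Lemma vdegV x e : vdeg x e -> vdeg x^-1 (- e).
Proof.
move=> [f [f0 ->]]; have [g [g0 gf]] := ps_unit _ f f0.
exists g; split=> //; rewrite invfM invr_expz; congr (_ * _).
have fN0 : f%:F != 0 by rewrite tofrac_eq0; apply: contraNneq f0 => ->.
by apply: (mulIf fN0); rewrite -tofracM gf tofrac1 mulVf.
Qed.

Lemma vdeg_neq0 x e : vdeg x e -> x != 0.
Proof.
move=> [f [f0 ->]]; rewrite mulf_neq0 ?lsuz_neq0 // tofrac_eq0.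
by apply: contraNneq f0 => ->.
Qed.

(** Numerator and denominator are powers of 1/t times series with non-zero constant coefficient; the
    degree comes from the difference of the exponents. *)
Lemma vdeg_exists x : x != 0 -> exists e, vdeg x e.
Proof.
have psdeg f : f != 0 -> exists e, vdeg f%:F e.
  move=> /psX_factor[k [g [g0 ->]]]; exists (- k%:Z), g; split=> //.
  by rewrite opprK tofracM -lsuXn.
elim/quotW: x => r r0.
have Er : (\pi_K r)%qT = (frac r).1%:F / (frac r).2%:F.
  apply: (canRL (mulfK _)); first by rewrite tofrac_eq0 denom_ratioP.
  rewrite /tofrac; unlock; rewrite -[LHS]FracField.pi_mul /FracField.mulf.
  apply/eqmodP; rewrite /= FracField.equivfE !numden_Ratio ?mulf_neq0 ?oner_eq0 ?denom_ratioP //.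
  by rewrite !mulr1 mulrC.
have n0 : (frac r).1 != 0.
  by apply: contraNneq r0 => n0; rewrite Er n0 tofrac0 mul0r.
have [a xa] := psdeg _ n0; have [b xb] := psdeg _ (denom_ratioP r).
by exists (a - b); rewrite Er; apply: vdegM => //; apply: vdegV.
Qed.

Lemma vdeg_le x a b : vdeg x a -> vle x b -> a <= b.
Proof.
move=> [f [f0 ->]] [g Eg]; rewrite leNgt; apply/negP => ltba.
have ltba1 : b <= a - 1 by lia.
move: Eg; rewrite (vle_widen _ _ g (ltW ltba)) => /(mulfI (lsuz_neq0 _))/eqP.
rewrite tofrac_eq => /eqP Ef; move: f0; rewrite Ef psXnM.
by case: leqP => h; rewrite ?eqxx //; lia.
Qed.

Lemma vdeg_uniq x a b : vdeg x a -> vdeg x b -> a = b.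
Proof.
move=> xa xb; apply/eqP; rewrite eq_le.
by rewrite (vdeg_le _ _ _ xa (vdegW _ _ xb)) (vdeg_le _ _ _ xb (vdegW _ _ xa)).
Qed.

Lemma vdegD x y a b : vdeg x a -> vle y b -> b < a -> vdeg (x + y) a.
Proof.
move=> [f [f0 ->]] [g ->] ltba; rewrite (vle_widen _ _ g (ltW ltba)) -mulrDr -tofracD.
eexists; split; last by [].
rewrite psDn psXnM; case: leqP => h; first lia.
by rewrite addr0.
Qed.

Definition constK : {rmorphism F -> K} := (tofrac (R:=pser F) \o psconst F).
Lemma comm_lsuV : commr_rmorph constK u^-1.
Proof. by move=> a; apply: mulrC. Qed.
(** Evaluation at [u^-1], that is, at t. *)
Definition polyK : {poly F} -> K := horner_morph comm_lsuV.
HB.instance Definition _ := GRing.RMorphism.copy polyK (horner_morph comm_lsuV).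

Lemma polyK0 : polyK 0 = 0. Proof. exact: rmorph0. Qed.
Lemma polyK1 : polyK 1 = 1. Proof. exact: rmorph1. Qed.
Lemma polyKD : {morph polyK : P Q / P + Q}. Proof. exact: rmorphD. Qed.
Lemma polyKB : {morph polyK : P Q / P - Q}. Proof. exact: rmorphB. Qed.
Lemma polyKM : {morph polyK : P Q / P * Q}. Proof. exact: rmorphM. Qed.

(** Multiplication by [u ^ d] lists the coefficients from exponent d downwards. *)
Lemma polyKE P d : (size P <= d.+1)%N ->
  polyK P = u ^ (- d%:Z) * (fun n => if (n <= d)%N then P`_(d - n) else 0 : F)%:F.
Proof.
move=> szP; rewrite /polyK /= /horner_morph.
rewrite (@horner_coef_wide _ d.+1); last first.
  by apply: leq_trans szP; apply: size_poly.
rewrite -invr_expz; apply: (canRL (mulKf (lsuz_neq0 _))).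
rewrite -exprnP mulr_sumr.
transitivity (\sum_(i < d.+1) (psX F ^+ (d - i) * psconst F P`_i)%:F).
  apply: eq_bigr => i _; rewrite coef_map /= tofracM tofracXn -/lsu.
  rewrite mulrCA mulrC; congr (_ * _); rewrite exprVn.
  have led : (i <= d)%N by rewrite -ltnS.
  by rewrite -{1}(subnK led) exprD mulfK // expf_neq0 // lsu_neq0.
rewrite -(rmorph_sum (tofrac (R:=pser F))); congr (tofrac _); apply/funext => n; rewrite pssumn.
case: leqP => [lend|ltdn]; last first.
  rewrite big1 // => i _; rewrite psXnM; case: leqP => // h.
  by rewrite /psconst; case: eqP => h'; [have := ltn_ord i; lia|rewrite mulr0n].
have h : (d - n < d.+1)%N by lia.
rewrite (bigD1 (Ordinal h)) //= psXnM subKn // leqnn subnn /psconst mulr1n big1 ?addr0 //.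
move=> i; rewrite -val_eqE /= => ine; rewrite psXnM; case: leqP => // h'.
by case: eqP => h''; [have := ltn_ord i; lia|rewrite mulr0n].
Qed.

Lemma vle_polyK P d : (size P <= d.+1)%N -> vle (polyK P) d.
Proof. by move=> /polyKE ->; eexists. Qed.

Lemma vdeg_polyK P : P != 0 -> vdeg (polyK P) (size P).-1.
Proof.
move=> P0; rewrite (polyKE P (size P).-1); last by rewrite leqSpred.
by eexists; split; last by []; rewrite /= subn0 -lead_coefE lead_coef_eq0.
Qed.

Lemma polyK_eq0 P : (polyK P == 0) = (P == 0).
Proof.
apply/idP/eqP => [/eqP i0|->]; last by rewrite polyK0.
by apply: contrapT => /eqP/vdeg_polyK/vdeg_neq0; rewrite i0 eqxx.
Qed.

Lemma vle_polyK_lt0 P e : vle (polyK P) e -> e < 0 -> P = 0.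
Proof.
move=> Pe e0; apply: contrapT => /eqP/vdeg_polyK/vdeg_le/(_ Pe); lia.
Qed.

Lemma size_vle_polyK P (d : nat) : vle (polyK P) d -> (size P <= d.+1)%N.
Proof.
move=> Pd; have [->|/vdeg_polyK/vdeg_le/(_ Pd)] := eqVneq P 0; first by rewrite size_poly0.
lia.
Qed.

(** The first e+1 coefficients belong to the exponents e down to 0; the rest has degree at most
    -1. *)
Lemma lau_split (e : nat) f : u ^ (- e%:Z) * f%:F =
  polyK (\poly_(i < e.+1) f (e - i)%N) + u * (fun n => f (n + e.+1)%N : F)%:F.
Proof.
rewrite (polyKE _ e) ?size_poly //.
rewrite [X in _ + X * _](_ : _ = u ^ (- e%:Z) * u ^ e.+1%:Z); last first.
  by rewrite -lsuzD (_ : _ + _ = 1) ?expr1z //; lia.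
rewrite -mulrA -mulrDr -exprnP lsuXn -tofracM -tofracD; congr (_ * tofrac _).
apply/funext => n; rewrite psDn psXnM coef_poly.
case: leqP => h; case: leqP => h'; rewrite ?add0r ?addr0 ?subnK //; try lia.
by rewrite subKn.
Qed.

(** Carries concrete series into the field, where [leq_l] becomes equality ([lauK_inj]). *)
Definition lauK (x : laur F) : K := u ^ (- lval x) * (lc x : pser F)%:F.

Lemma lauK_mul (x y : laur F) : lauK (lmul x y) = lauK x * lauK y.
Proof. by rewrite /lauK /= opprD lsuzD mulrACA -tofracM. Qed.

Lemma lauK_widen (x : laur F) V : lval x <= V ->
  lauK x = u ^ (- V) * (fun n => lcoef x (V - n%:Z) : F)%:F.
Proof.
move=> leV; rewrite /lauK (vle_widen _ _ _ leV); congr (_ * tofrac _).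
apply/funext => n; rewrite psXnM /lcoef.
by case: leqP => h; case: ifP => h' //; try lia; congr (lc x _); lia.
Qed.

Lemma lauK_add (x y : laur F) : lauK (ladd x y) = lauK x + lauK y.
Proof.
set V := Num.max (lval x) (lval y).
rewrite (lauK_widen x V) ?le_max ?lexx // (lauK_widen y V) ?le_max ?lexx ?orbT //.
by rewrite -mulrDr -tofracD.
Qed.

Lemma lauK_opp (x : laur F) : lauK (lopp x) = - lauK x.
Proof. by rewrite /lauK /= -mulrN -tofracN. Qed.

Lemma lauK_poly P : lauK (lpoly P) = polyK P.
Proof. by rewrite (polyKE P (size P)). Qed.

Lemma lauK_inj (x y : laur F) : leq_l x y <-> lauK x = lauK y.
Proof.
pose V := Num.max (lval x) (lval y).
have xV : lval x <= V by rewrite le_max lexx.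
have yV : lval y <= V by rewrite le_max lexx orbT.
rewrite (lauK_widen x V xV) (lauK_widen y V yV); split=> [exy|].
  by congr (_ * tofrac _); apply/funext => n.
move=> /(mulfI (lsuz_neq0 _))/eqP; rewrite tofrac_eq => /eqP Exy e.
have [leeV|ltVe] := lerP e V.
  have := congr1 (@^~ `|V - e|%N) Exy; rewrite /=.
  by have -> : V - `|V - e|%N%:Z = e by lia.
by rewrite /lcoef; case: ifP => h1; case: ifP => h2 //; lia.
Qed.

Lemma lauK_surj x : exists z : laur F, lauK z = x.
Proof.
have [->|/vdeg_exists[e [f [_ ->]]]] := eqVneq x 0.
  by exists (lpoly 0); rewrite lauK_poly polyK0.
by exists (Laur e f).
Qed.

Lemma polypartP (x : laur F) : vle (lauK x - polyK (polypart x)) (-1).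
Proof.
pose f : pser F := fun n => lcoef x (`|lval x|%N%:Z - n%:Z).
have -> : polypart x = \poly_(i < `|lval x|.+1) f (`|lval x| - i)%N.
  apply/polyP => i; rewrite !coef_poly; case: ltnP => // h.
  by rewrite /f; congr (lcoef x _); lia.
(* [polypart] reads |lval x| + 1 coefficients even when [lval x] is negative; widening to |lval x|
   treats both signs alike. *)
have -> := lauK_widen x `|lval x|%N (lez_abs _).
rewrite (lau_split _ f) [X in X - _]addrC addrK.
by eexists; rewrite opprK expr1z.
Qed.
End LaurentField.

(** * Continued fractions *)

Section ContinuedFraction.
Variable F : fieldType.
Local Notation K := {fraction (pser F)}.
Local Notation polyK := (polyK F).
Implicit Types (x y : K) (P Q : {poly F}).

(** [polypart] acts on concrete series, so a representative of x is chosen; [pquoP] holds for any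
    choice. *)
Definition pquo x : {poly F} := polypart (sval (cid (lauK_surj _ x))).
(* Complete quotients: x_0 = x and x_(i+1) = 1 / (x_i - [x_i]). *)
Fixpoint cquo x (i : nat) : K :=
  if i is i'.+1 then (cquo x i' - polyK (pquo (cquo x i')))^-1 else x.
Definition pq x i := pquo (cquo x i).
Definition pqdeg x i := (size (pq x i)).-1.

Lemma pquoP x : vle _ (x - polyK (pquo x)) (-1).
Proof. by rewrite /pquo; case: cid => y /= {1}<-; apply: polypartP. Qed.

Definition irrational x := forall P Q, Q != 0 -> polyK Q * x <> polyK P.

Lemma irrational_sub x P : irrational x -> x - polyK P != 0.
Proof.
move=> irx; apply/eqP => /subr0_eq xP; apply: (irx P 1); rewrite ?oner_neq0 //.
by rewrite polyK1 mul1r.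
Qed.

Lemma irrational_cquo x i : irrational x -> irrational (cquo x i).
Proof.
move=> irx; elim: i => //= i IH P Q Q0 QP.
have xa := irrational_sub _ (pq x i) IH.
have PxQ : polyK P * (cquo x i - polyK (pq x i)) = polyK Q by rewrite -QP divfK.
have P0 : P != 0.
  by apply: contraNneq Q0 => P0; rewrite -polyK_eq0 -PxQ P0 polyK0 mul0r.
apply: (IH (Q + P * pq x i) P P0).
by rewrite polyKD polyKM -PxQ -mulrDr subrK.
Qed.

Lemma cquo_sub x i : cquo x i - polyK (pq x i) = (cquo x i.+1)^-1.
Proof. by rewrite /= invrK. Qed.

Lemma vle_cquoV x i : vle _ (cquo x i.+1)^-1 (-1).
Proof. by rewrite -cquo_sub; apply: pquoP. Qed.

Lemma cquoS_neq0 x i : irrational x -> cquo x i.+1 != 0.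
Proof. by move=> irx; rewrite invr_eq0 irrational_sub //; apply: irrational_cquo. Qed.

(** The remainder x_i - A_i has degree at most -1, so its inverse has degree at least 1, and that
    degree is carried by the polynomial part. *)
Lemma vdeg_cquo x i : irrational x ->
  vdeg _ (cquo x i.+1) (pqdeg x i.+1) /\ (0 < pqdeg x i.+1)%N.
Proof.
move=> irx; have x0 := cquoS_neq0 _ i irx.
have [e xe] := vdeg_exists _ _ x0.
have e1 := vdeg_le _ _ _ _ (vdegV _ _ _ xe) (vle_cquoV x i).
have pe : vdeg _ (polyK (pq x i.+1)) e.
  rewrite -[polyK _](subKr (cquo x i.+1)); apply: (vdegD _ _ _ _ (-1)) => //.
    by apply: vleN; apply: pquoP.
  lia.
have p0 : pq x i.+1 != 0 by rewrite -polyK_eq0; apply: vdeg_neq0 pe.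
have ee := vdeg_uniq _ _ _ _ pe (vdeg_polyK _ _ p0).
by rewrite /pqdeg -ee; split=> //; move: ee e1; lia.
Qed.

Lemma is_cf_pq (z : laur F) : irrational (lauK _ z) -> is_cf z (pq (lauK _ z)).
Proof.
move=> irz; exists (fun i => sval (cid (lauK_surj _ (cquo (lauK _ z) i)))).
have svalK y : lauK F (sval (cid (lauK_surj _ y))) = y by case: cid.
split=> [|i]; first by apply/lauK_inj; rewrite svalK.
split=> //; apply/lauK_inj.
rewrite lauK_mul lauK_add lauK_opp !lauK_poly !svalK cquo_sub mulVf ?polyK1 //.
exact: cquoS_neq0.
Qed.

(* The pair holds the i-th and the (i-1)-st terms of the recurrence. *)
Fixpoint cvgt x (z : {poly F} * {poly F}) i :=
  if i is i'.+1 then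
    let w := cvgt x z i' in (pq x i'.+1 * w.1 + w.2, w.1)
  else z.
Definition cnum x i := cvgt x (pq x 0, 1) i.
Definition cden x i := cvgt x (1, 0) i.
(** The degree of the i-th denominator ([vdeg_cden]); A_0 only enters the numerators. *)
Definition cdeg x i := (\sum_(1 <= j < i.+1) pqdeg x j)%N.

Lemma cdegS x i : cdeg x i.+1 = (cdeg x i + pqdeg x i.+1)%N.
Proof. by rewrite /cdeg big_nat_recr. Qed.

Lemma cvgt_det x i :
  (cnum x i).1 * (cden x i).2 - (cnum x i).2 * (cden x i).1 = (-1) ^+ i.+1.
Proof.
elim: i => [|i IH]; first by rewrite /= mulr0 mulr1 sub0r expr1.
by rewrite exprS -IH /=; ring.
Qed.

Definition cerr x i := polyK (cden x i).1 * x - polyK (cnum x i).1.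
Definition cerr' x i := polyK (cden x i).2 * x - polyK (cnum x i).2.

(** Passing from one convergent to the next divides the error q x - p by -x_(i+1), so its degree
    drops by deg A_(i+1). *)
Lemma cerr_cquo x i : irrational x -> cerr x i * cquo x i.+1 = - cerr' x i.
Proof.
move=> irx; elim: i => [|i IH].
  rewrite /cerr /cerr' /= !polyK1 polyK0 mul0r sub0r opprK mul1r mulfV //.
  exact: irrational_sub.
have -> : cerr x i.+1 = cerr x i * polyK (pq x i.+1) + cerr' x i.
  by rewrite /cerr /cerr' /= !polyKD !polyKM; ring.
rewrite -[cerr' x i]opprK -IH -mulrBr -opprB mulrN cquo_sub mulNr mulfVK //.
exact: cquoS_neq0.
Qed.

Lemma vdeg_cerr x i : irrational x -> vdeg _ (cerr x i) (- (cdeg x i.+1)%:Z).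
Proof.
move=> irx; have cq j : cerr x j = - cerr' x j * (cquo x j.+1)^-1.
  by rewrite -cerr_cquo // mulfK // cquoS_neq0.
have step j a : vdeg _ (cerr' x j) a -> vdeg _ (cerr x j) (a - (pqdeg x j.+1)%:Z).
  move=> ea; rewrite cq; apply: vdegM; first exact: vdegN.
  by apply: vdegV; case: (vdeg_cquo x j irx).
elim: i => [|i IH].
  rewrite -[- _]add0r cdegS /cdeg big_geq // add0n; apply: step.
  rewrite /cerr' /= polyK0 mul0r sub0r; apply: vdegN.
  by have := vdeg_polyK F 1 (oner_neq0 _); rewrite size_poly1.
by rewrite cdegS PoszD opprD; apply: step; exact: IH.
Qed.

Lemma vdeg_cden x i : irrational x -> vdeg _ (polyK (cden x i).1) (cdeg x i).
Proof.
move=> irx; suff [] : vdeg _ (polyK (cden x i).1) (cdeg x i) /\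
  vle _ (polyK (cden x i).2) ((cdeg x i)%:Z - 1) by [].
elim: i => [|i [IH IH']].
  rewrite /cdeg big_geq //= polyK0; split; last exact: vle0.
  by have := vdeg_polyK F 1 (oner_neq0 _); rewrite size_poly1.
have [_ d0] := vdeg_cquo x i irx.
have p0 : pq x i.+1 != 0.
  by apply: contraTneq d0 => p0; rewrite /pqdeg p0 size_poly0.
rewrite cdegS PoszD /= polyKD polyKM; split; last first.
  by apply: vle_mono (vdegW _ _ _ IH) _; lia.
apply: vdegD; [|exact: IH'|lia].
by rewrite addrC; apply: vdegM => //; apply: vdeg_polyK.
Qed.

(* P/Q would agree with the i-th convergent, whose numerator and denominator
   are coprime. *)
Lemma best_approx x i P Q : irrational x -> (size Q <= cdeg x i)%N ->
  vle _ (polyK Q * x - polyK P) (- (cdeg x i).+1%:Z) -> Q = 0.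
Proof.
move=> irx szQ QP; set p := (cnum x i).1; set q := (cden x i).1.
have [|Q0] := eqVneq Q 0 => //; exfalso.
have qd := vdeg_cden x i irx.
have [_ d0] := vdeg_cquo x i irx.
(* This polynomial equals q (Q x - P) - Q (q x - p), where both terms have negative degree. *)
have QpPq : Q * p - P * q = 0.
  apply: (vle_polyK_lt0 _ _ (-1)) => //.
  rewrite polyKB !polyKM.
  have -> : polyK Q * polyK p - polyK P * polyK q =
     polyK q * (polyK Q * x - polyK P) - polyK Q * cerr x i.
    by rewrite /cerr -/p -/q; ring.
  apply: vleB.
    apply: (vle_mono _ _ (vleM _ _ _ _ _ (vdegW _ _ _ qd) QP)); lia.
  have vQ : vle _ (polyK Q) (size Q).-1 by apply: vle_polyK; rewrite leqSpred.
  apply: (vle_mono _ _ (vleM _ _ _ _ _ vQ (vdegW _ _ _ (vdeg_cerr x i irx)))).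
  have := cdegS x i; move: Q0; rewrite -size_poly_gt0; lia.
have q0 : q != 0 by rewrite -polyK_eq0; apply: vdeg_neq0 qd.
have szq : size q = (cdeg x i).+1.
  have := vdeg_uniq _ _ _ _ qd (vdeg_polyK _ _ q0).
  by move: q0; rewrite -size_poly_gt0 -/q; lia.
(* As the determinant of consecutive convergents is a sign, q divides Q, whose degree is smaller. *)
have EQ : (-1) ^+ i.+1 * Q = q * (P * (cden x i).2 - Q * (cnum x i).2).
  rewrite -(cvgt_det x) -/p -/q; apply/eqP; rewrite -subr_eq0; apply/eqP.
  by transitivity ((Q * p - P * q) * (cden x i).2); [ring|rewrite QpPq mul0r].
pose Z : {poly F} := P * (cden x i).2 - Q * (cnum x i).2; rewrite -/Z in EQ.
have Z0 : Z != 0.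
  apply: contraNneq Q0 => Z0; move: EQ; rewrite Z0 mulr0 => /eqP.
  by rewrite mulf_eq0 signr_eq0.
have /= : size ((-1) ^+ i.+1 * Q) = size (q * Z) by rewrite EQ.
rewrite size_Msign size_mul // szq; move: Z0; rewrite -size_poly_gt0; case: (size Z) => // n _ Esz.
by move: szQ; rewrite Esz addnS /= addSn ltnNge leq_addr.
Qed.

End ContinuedFraction.

(** * Convergents and the number wall *)

Section Hankel.
Variable F : fieldType.
Implicit Types (s : nat -> F) (P Q : {poly F}).

(* A kernel vector of the Toeplitz matrix gives a denominator Q of degree at
   most a for which Q theta t^k is within t^-(a+2) of a polynomial. *)
Lemma wall_eq0_approx s a k : wall s a (a + k) = 0 ->
  exists Q P, [/\ Q != 0, (size Q <= a.+1)%N &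
    vle _ (polyK _ Q * lauK _ (lmul (theta s) (lpoly 'X^k)) - polyK _ P)
      (- a.+2%:Z)].
Proof.
move=> /eqP/det0P[v v0 vM].
(* The kernel vector lists the coefficients of Q from the top; [rv] does the same for Q t^k, so
   [g n] is the coefficient of t^(d-1-n) in Q theta t^k. *)
pose Q := \poly_(j < a.+1) v 0 (inord (a - j)).
pose d := (a + k)%N.
pose rv : pser F := fun n => if (n <= d)%N then (Q * 'X^k)`_(d - n) else 0.
pose g := rv * s : pser F.
have rvE n : rv n = if (n <= a)%N then v 0 (inord n) else 0.
  rewrite /rv coefMXn coef_poly /d; have [lena|ltan] := leqP n a.
    have [-> -> ->] : [/\ (n <= a + k)%N, (a + k - n < k)%N = false &
      (a + k - n - k)%N = (a - n)%N] by split; lia.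
    by rewrite ltnS leq_subr subKn.
  by case: ifP => // h1; have -> : (a + k - n < k)%N by lia.
(* The a+1 kernel equations are the vanishing of the coefficients of t^-1, ..., t^-(a+1). *)
have g0 n : (n <= a)%N -> g (n + d)%N = 0.
  move=> lena; rewrite /g psMn.
  have := congr1 (fun M : 'rV_a.+1 => M 0 (Ordinal (lena : n < a.+1)%N)) vM.
  rewrite !mxE => vn; rewrite -[RHS]vn.
  rewrite (eq_bigr (fun i : 'I_ _ =>
    if (i < a.+1)%N then v 0 (inord i) * s (n + d - i)%N else 0)); last first.
    by move=> i _; rewrite rvE ltnS; case: ifP; rewrite ?mul0r.
  have le1 : (a.+1 <= (n + d).+1)%N by rewrite /d; lia.
  rewrite -big_mkcond -(big_ord_widen _ (fun i => v 0 (inord i) * s (n + d - i)%N) le1).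
  apply: eq_bigr => i _; rewrite mxE inord_val; congr (_ * _).
  have -> : ((a + k)%N%:Z - (i : nat)%:Z + n%:Z) = (n + d - i)%N%:Z.
    by have := ltn_ord i; rewrite /d; lia.
  by [].
exists Q, (\poly_(i < d.+1) (psX F * g) (d - i)%N); split.
- apply: contraNneq v0 => Q0; apply/eqP/rowP => i; rewrite mxE.
  have := rvE i; rewrite -ltnS ltn_ord inord_val => <-.
  by rewrite /rv Q0 mul0r coef0; case: ifP.
- exact: size_poly.
have -> : polyK F Q * lauK F (lmul (theta s) (lpoly 'X^k)) =
    lsu F ^ (- d%:Z) * (psX F * g)%:F.
  rewrite lauK_mul lauK_poly mulrCA -polyKM (polyKE _ _ d); last first.
    apply: leq_trans (size_polyMleq _ _) _; rewrite size_polyXn.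
    have szQ : (size Q <= a.+1)%N by apply: size_poly.
    by rewrite addnS /= /d -addSn leq_add2r.
  by rewrite /lauK /= opprK expr1z mulrCA !tofracM -!mulrA [s%:F * _]mulrC.
rewrite lau_split [X in X - _]addrC addrK.
pose h : pser F := fun n => g (n + a.+1 + d)%N.
have -> : (fun n => (psX F * g) (n + d.+1)%N) = psX F ^+ a.+1 * h.
  apply/funext => n; transitivity (g (n + d)%N).
    by rewrite addnS; exact: (psXM _ g (n + d).+1).
  symmetry; etransitivity; first exact: (psXnM _ a.+1 h n).
  by case: leqP => len; [rewrite (g0 n)|rewrite /h subnK].
exists h.
by rewrite tofracM -lsuXn mulrA -exprS opprK.
Qed.

(** For a + 1 equal to the degree of the denominator, the approximation given by a zero of the wall
    is exactly what [best_approx] excludes. *)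
Lemma wall_cdeg_neq0 s k i : let x := lauK _ (lmul (theta s) (lpoly 'X^k)) in
  irrational _ x -> (0 < cdeg _ x i)%N ->
  wall s (cdeg _ x i).-1 ((cdeg _ x i).-1 + k) != 0.
Proof.
move=> x irx r0; apply/eqP => /wall_eq0_approx[Q [P [Q0 szQ QP]]].
move: Q0; rewrite (best_approx _ x i P Q) ?eqxx //; first by rewrite -(prednK r0).
by move: QP; rewrite (prednK r0).
Qed.

End Hankel.

(** * Lagrange's theorem: quadratic irrationals have eventually periodic expansions *)

(* Substituting X = A + 1/X' in aX^2 + bX + c gives the quadratic equation with
   coefficients aA^2 + bA + c, 2aA + b and a for X'. *)
Lemma quad_step_root (K : fieldType) (a b c A phi : K) : phi != 0 ->
  a * (A + phi) ^+ 2 + b * (A + phi) + c = 0 ->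
  (a * A ^+ 2 + b * A + c) * phi^-1 ^+ 2 + (a * A *+ 2 + b) * phi^-1 + a = 0.
Proof.
move=> phi0 root; transitivity ((a * (A + phi) ^+ 2 + b * (A + phi) + c) / phi ^+ 2).
  by field.
by rewrite root mul0r.
Qed.

Lemma quad_step_disc (K : fieldType) (a b c A phi : K) : phi != 0 ->
  a * (A + phi) ^+ 2 + b * (A + phi) + c = 0 ->
  (a * A ^+ 2 + b * A + c) * phi^-1 *+ 2 + (a * A *+ 2 + b) =
  - (a * (A + phi) *+ 2 + b).
Proof.
move=> phi0 root; apply/eqP; rewrite -addr_eq0; apply/eqP.
transitivity ((a * (A + phi) ^+ 2 + b * (A + phi) + c) / phi *+ 2).
  by field.
by rewrite root mul0r mul0rn.
Qed.

(** Taylor expansion of the quadratic polynomial at its root A + phi. *)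
Lemma quad_step_lead (K : fieldType) (a b c A phi : K) :
  a * (A + phi) ^+ 2 + b * (A + phi) + c = 0 ->
  a * A ^+ 2 + b * A + c = a * phi ^+ 2 - (a * (A + phi) *+ 2 + b) * phi.
Proof.
move=> root; apply/eqP; rewrite -subr_eq0; apply/eqP.
by transitivity (a * (A + phi) ^+ 2 + b * (A + phi) + c); [ring|].
Qed.

Lemma quad_three_roots (K : fieldType) (a b c x y z : K) : a != 0 ->
  a * x ^+ 2 + b * x + c = 0 -> a * y ^+ 2 + b * y + c = 0 ->
  a * z ^+ 2 + b * z + c = 0 -> [\/ x = y, x = z | y = z].
Proof.
move=> a0 rx ry rz.
have key w : a * w ^+ 2 + b * w + c = 0 -> w = x \/ a * w = - (a * x + b).
  move=> rw; have : (w - x) * (a * w + (a * x + b)) = 0.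
    transitivity ((a * w ^+ 2 + b * w + c) - (a * x ^+ 2 + b * x + c)); first by ring.
    by rewrite rw rx subr0.
  move/eqP; rewrite mulf_eq0 subr_eq0 addr_eq0 => /orP[/eqP|/eqP]; by [left|right].
have [->|ay] := key y ry; first by constructor 1.
have [->|az] := key z rz; first by constructor 2.
by constructor 3; apply: (mulfI a0); rewrite ay az.
Qed.

(** Otherwise every value has an index from which it no longer occurs, and the maximum of these
    indices leaves no value for [g]. *)
Lemma infinite_fiber (T : finType) (g : nat -> T) :
  exists t, forall N, exists2 i, (N <= i)%N & g i = t.
Proof.
apply: contrapT => /forallNP nog.
have /choice[N NP] t : exists N, forall i, (N <= i)%N -> g i != t.
  have /existsNP[N hN] := nog t; exists N => i leNi.
  by apply/eqP => gi; apply: hN; exists i.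
have := NP (g (\max_t N t)) (\max_t N t) (leq_bigmax _).
by rewrite eqxx.
Qed.

Section Lagrange.
Variable F : finFieldType.
Local Notation K := {fraction (pser F)}.
Local Notation polyK := (polyK F).
Implicit Types (x : K) (a b c P Q : {poly F}).

Definition quad_root a b c x := polyK a * x ^+ 2 + polyK b * x + polyK c = 0.

(* Coefficients of a quadratic equation satisfied by the i-th complete quotient,
   given one (z) satisfied by x. *)
Fixpoint qform x (z : {poly F} * {poly F} * {poly F}) i :=
  if i is i'.+1 then
    let: (a, b, c) := qform x z i' in let A := pq _ x i' in
    (a * A ^+ 2 + b * A + c, a * A *+ 2 + b, a)
  else z.

Lemma vle_exists x : exists B : nat, vle _ x B.
Proof.
have [->|/vdeg_exists[e xe]] := eqVneq x 0; first by exists 0%N; apply: vle0.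
by exists `|e|%N; apply: (vle_mono _ _ (vdegW _ _ _ xe)); lia.
Qed.

(** If A were a root, division by x - A would leave a linear equation for the irrational x. *)
Lemma quad_lead_neq0 x a b c A : irrational _ x -> a != 0 -> quad_root a b c x ->
  a * A ^+ 2 + b * A + c != 0.
Proof.
move=> irx a0 rx; apply/eqP => rA.
have xA := irrational_sub _ x A irx.
apply: (irx (- (a * A + b)) a a0); apply: (mulIf xA).
apply/eqP; rewrite -subr_eq0; apply/eqP.
transitivity (polyK a * x ^+ 2 + polyK b * x + polyK c - polyK (a * A ^+ 2 + b * A + c)).
  by rewrite -[- (_ + b)]sub0r expr2 !(polyKB, polyKD, polyKM) polyK0; ring.
by rewrite rx rA polyK0 subr0.
Qed.

(** Invariant along the expansion. The constant coefficient is controlled through the preceding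
    form, whose leading coefficient it is. *)
Definition qbounded x z (B : nat) i :=
  let: (a, b, c) := qform x z i in
  [/\ a != 0, quad_root a b c (cquo _ x i),
      vle _ (polyK a * cquo _ x i *+ 2 + polyK b) B & vle _ (polyK a) B].

(* The discriminant root 2ax + b only changes sign along the expansion; it
   bounds the degrees of all coefficients of the forms. *)
Lemma qform_bounded x a b c : irrational _ x -> a != 0 -> quad_root a b c x ->
  exists B : nat, forall i, qbounded x (a, b, c) B i /\
    vle _ (polyK (qform x (a, b, c) i.+1).1.2) B.
Proof.
move=> irx a0 rx.
have [B1 vB1] := vle_exists (polyK a * x *+ 2 + polyK b).
have [B2 vB2] := vle_exists (polyK a).
exists (B1 + B2)%N => i; set B := (B1 + B2)%N.
have step j : qbounded x (a, b, c) B j -> qbounded x (a, b, c) B j.+1 /\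
    vle _ (polyK (qform x (a, b, c) j.+1).1.2) B.
  rewrite /qbounded /=; case: (qform x (a, b, c) j) => [[a' b'] c'] [a'0 r' D' vB].
  set A := pq _ x j; pose phi := (cquo _ x j.+1)^-1.
  have irj := irrational_cquo _ x j irx.
  have phi0 : phi != 0 by rewrite invr_eq0; apply: cquoS_neq0.
  have vphi : vle _ phi (-1) by apply: vle_cquoV.
  have xE : cquo _ x j = polyK A + phi by rewrite /phi -cquo_sub addrC subrK.
  have xE' : (cquo _ x j - polyK (pquo _ (cquo _ x j)))^-1 = phi^-1.
    by rewrite -[_^-1]/(cquo _ x j.+1) /phi invrK.
  have lE : polyK (a' * A ^+ 2 + b' * A + c') =
      polyK a' * polyK A ^+ 2 + polyK b' * polyK A + polyK c'.
    by rewrite !expr2 !(polyKD, polyKM).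
  have bE : polyK (a' * A *+ 2 + b') = polyK a' * polyK A *+ 2 + polyK b'.
    by rewrite !mulr2n !(polyKD, polyKM).
  have r2 : polyK a' * (polyK A + phi) ^+ 2 + polyK b' * (polyK A + phi) + polyK c' = 0.
    by rewrite -xE.
  rewrite xE in D'.
  have vaphi : vle _ (polyK a' * phi) (B%:Z - 1) by apply: vleM.
  split; [split|].
  - exact: (quad_lead_neq0 _ _ _ _ A irj a'0 r').
  - by rewrite /quad_root xE' lE bE; apply: quad_step_root.
  - by rewrite xE' lE bE quad_step_disc //; apply: vleN.
  - rewrite lE (quad_step_lead _ _ _ _ _ phi r2); apply: vleB.
      rewrite expr2 mulrA; apply: (vle_mono _ _ (vleM _ _ _ _ _ vaphi vphi)); lia.
    apply: (vle_mono _ _ (vleM _ _ _ _ _ D' vphi)); lia.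
  - rewrite bE.
    have -> : polyK a' * polyK A *+ 2 + polyK b' =
      (polyK a' * (polyK A + phi) *+ 2 + polyK b') - (polyK a' * phi + polyK a' * phi).
      by ring.
    apply: vleB => //; apply: (vle_mono _ _ (_ : vle _ _ (B%:Z - 1))); last lia.
    exact: vleD.
suff H : qbounded x (a, b, c) B i by split=> //; case: (step i H).
elim: i => [|j /step[]//]; split=> //.
  by apply: (vle_mono _ _ vB1); rewrite /B; lia.
by apply: (vle_mono _ _ vB2); rewrite /B; lia.
Qed.

Lemma cquo_period x i j n : cquo _ x i = cquo _ x j -> cquo _ x (i + n) = cquo _ x (j + n).
Proof. by move=> e; elim: n => [|n IH]; rewrite ?addn0 // !addnS /= IH. Qed.

(** Over a finite field there are finitely many forms of bounded degree, so one recurs infinitely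
    often; two of three complete quotients that share it coincide. *)
Lemma pq_eventually_periodic x a b c : irrational _ x -> a != 0 -> quad_root a b c x ->
  exists N l, (0 < N)%N /\ is_period (pq _ x) N l.
Proof.
move=> irx a0 rx; have [B HB] := qform_bounded _ _ _ _ irx a0 rx.
pose code (P : {poly F}) : {ffun 'I_B.+1 -> F} := [ffun i : 'I_B.+1 => P`_i].
have codeI P Q : vle _ (polyK P) B -> vle _ (polyK Q) B -> code P = code Q -> P = Q.
  move=> /size_vle_polyK szP /size_vle_polyK szQ /ffunP PQ; apply/polyP => i.
  have [ltiB|leBi] := ltnP i B.+1; first by have := PQ (Ordinal ltiB); rewrite !ffunE.
  by rewrite !nth_default // (leq_trans _ leBi).
(* The index n+1 is used because the bounds on the middle and constant coefficients come from the
   preceding form. *)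
pose g n := let: (a', b', c') := qform x (a, b, c) n.+1 in (code a', code b', code c').
have [t tP] := infinite_fiber _ g.
have [i _ gi] := tP 0%N; have [j ltij gj] := tP i.+1; have [k ltjk gk] := tP j.+1.
have qv n : let: (a', b', c') := qform x (a, b, c) n.+1 in
    [/\ a' != 0, quad_root a' b' c' (cquo _ x n.+1), vle _ (polyK a') B,
        vle _ (polyK b') B & vle _ (polyK c') B].
  have [_ vb] := HB n; have [] := HB n.+1; rewrite /qbounded.
  case E : (qform _ _ n.+1) => [[a' b'] c'] [a'0 r' _ va'] _; split=> //.
    by move: vb; rewrite E.
  have [+ _] := HB n; move: E; rewrite /qbounded /=.
  by case: (qform _ _ n) => [[a1 b1] c1] [_ _ <-] [].
have same m n : g m = g n -> qform x (a, b, c) m.+1 = qform x (a, b, c) n.+1.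
  rewrite /g; have := qv m; have := qv n.
  case: (qform _ _ m.+1) => [[a1 b1] c1]; case: (qform _ _ n.+1) => [[a2 b2] c2].
  move=> [_ _ va2 vb2 vc2] [_ _ va1 vb1 vc1] [/codeI Ea /codeI Eb /codeI Ec].
  by rewrite Ea // Eb // Ec.
have : [\/ cquo _ x i.+1 = cquo _ x j.+1, cquo _ x i.+1 = cquo _ x k.+1
       | cquo _ x j.+1 = cquo _ x k.+1].
  have := qv i; have := qv j; have := qv k.
  rewrite (same k i) ?gi ?gk // (same j i) ?gi ?gj //.
  case: (qform _ _ i.+1) => [[a1 b1] c1] [a10 rk _ _ _] [_ rj _ _ _] [_ ri _ _ _].
  by apply: quad_three_roots ri rj rk; rewrite polyK_eq0.
have conclude m n : (m < n)%N -> cquo _ x m.+1 = cquo _ x n.+1 ->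
    exists N l, (0 < N)%N /\ is_period (pq _ x) N l.
  move=> ltmn e; exists m.+1, (n - m)%N; split=> //; split; first by rewrite subn_gt0.
  move=> r ler; rewrite /pq; congr (pquo _ _).
  rewrite -(subnKC ler) -(cquo_period _ _ _ _ (esym e)).
  by congr (cquo _ _ _); lia.
by case; apply: conclude => //; apply: leq_trans ltjk; apply: ltnW.
Qed.

(** The start is kept at or above N so that A_0, which may be constant, can be excluded from the
    period. *)
Lemma min_period_exists (A : nat -> {poly F}) N l : is_period A N l ->
  exists N' l', (N <= N')%N /\ min_period A N' l'.
Proof.
move=> per; have exl : exists l, `[< exists N, is_period A N l >].
  by exists l; apply/asboolP; exists N.
case: (ex_minnP exl) => l' /asboolP[N' [l0 per']] minl.
exists (maxn N N'), l'; split; first exact: leq_maxl.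
split; last by move=> N1 l1 per1; apply: minl; apply/asboolP; exists N1.
by split=> // i lei; apply: per'; apply: leq_trans lei; apply: leq_maxr.
Qed.

(** An equation with coefficients a, b, c for theta gives one with a, b t^k, c t^(2k) for theta
    t^k. *)
Lemma quad_irrational_lauK (s : nat -> F) k : quad_irrational (theta s) ->
  let x := lauK _ (lmul (theta s) (lpoly 'X^k)) in
  irrational _ x /\ exists a b c, a != 0 /\ quad_root a b c x.
Proof.
move=> [[a [b [c [a0 quad]]]] irr] /=; rewrite lauK_mul lauK_poly.
set th := lauK _ _; split.
  move=> P Q Q0 QP; apply: irr; exists P, (Q * 'X^k); split.
    by rewrite mulf_neq0 // expf_neq0 // polyX_eq0.
  by apply/lauK_inj; rewrite lauK_mul !lauK_poly polyKM -/th -QP; ring.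
exists a, (b * 'X^k), (c * 'X^k * 'X^k); split=> //.
move/lauK_inj: quad; rewrite !lauK_add !lauK_mul !lauK_poly polyK0 -/th => quad.
rewrite /quad_root !polyKM.
transitivity ((polyK a * (th * th) + polyK b * th + polyK c) * polyK 'X^k ^+ 2).
  by ring.
by rewrite quad mul0r.
Qed.

End Lagrange.

(** * Period length against non-zero entries on a diagonal *)

Section Counting.
Variable F : finFieldType.

Definition wcount (s : nat -> F) (k T : nat) : nat :=
  (\sum_(0 <= a < T) (wall s a (a + k) != 0)%R)%N.

Lemma wcount_mono s k T T' : (T <= T')%N -> (wcount s k T <= wcount s k T')%N.
Proof. by move=> leT; rewrite /wcount (big_cat_nat _ leT) //= leq_addr. Qed.

(** Denominator degrees increase strictly, so the convergents 1 to i mark distinct non-zero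
    entries. *)
Lemma wcount_cdeg s k i : let x := lauK _ (lmul (theta s) (lpoly 'X^k)) in
  irrational _ x -> (i <= wcount s k (cdeg _ x i))%N.
Proof.
move=> x irx; elim: i => [//|i IH].
have [_ d0] := vdeg_cquo _ x i irx.
have c0 : (0 < cdeg _ x i.+1)%N by rewrite cdegS ltn_addl.
have := wall_cdeg_neq0 _ s k i.+1 irx c0; rewrite -/x => nz.
rewrite -(prednK c0) /wcount big_nat_recr //= nz addn1 ltnS.
by apply: (leq_trans IH); apply: wcount_mono; move: d0; rewrite cdegS; lia.
Qed.

Lemma sum_period (f : nat -> nat) N l j : (0 < N)%N ->
  (forall i, (N <= i)%N -> f (i + l)%N = f i) ->
  (\sum_(1 <= i < N + j * l) f i =
   \sum_(1 <= i < N) f i + j * \sum_(N <= i < N + l) f i)%N.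
Proof.
move=> N0 per; elim: j => [|j IH]; first by rewrite !mul0n !addn0.
have perj r i : (N <= i)%N -> f (i + r * l)%N = f i.
  move=> lei; elim: r => [|r IHr]; first by rewrite addn0.
  by rewrite mulSn addnCA addnC per ?IHr //; lia.
rewrite (@big_cat_nat _ _ _ (N + j * l)) /=; [|lia|rewrite mulSn; lia].
rewrite IH mulSn -addnA [X in _ = _ + X]addnC; congr (_ + (_ + _))%N.
rewrite -{1}[(N + j * l)%N]/(N + j * l)%N big_addn.
rewrite (_ : (N + (l + j * l) - j * l = N + l)%N); last lia.
by rewrite !big_nat; apply: eq_bigr => i /andP[lei _]; apply: perj.
Qed.

(** After j full periods the denominator has degree S + j D, and at least j l convergents have been
    counted. *)
Lemma cf_wcount (s : nat -> F) k : quad_irrational (theta s) ->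
  exists A N l C, [/\ is_cf (lmul (theta s) (lpoly 'X^k)) A, min_period A N l,
    (0 < \sum_(N <= i < N + l) (size (A i)).-1)%N &
    forall T, (T * l <=
      (wcount s k T + C) * \sum_(N <= i < N + l) (size (A i)).-1)%N].
Proof.
move=> /(quad_irrational_lauK _ _ k) /=; set x := lauK _ _ => -[irx [a [b [c [a0 rx]]]]].
have [N0 [l0 [N00 per0]]] := pq_eventually_periodic _ _ _ _ _ irx a0 rx.
have [N [l [leN minp]]] := min_period_exists _ _ _ _ per0.
have [[l0' per] _] := minp; have Npos := leq_trans N00 leN.
set D := (\sum_(N <= i < N + l) (size (pq _ x i)).-1)%N.
have D0 : (0 < D)%N.
  rewrite /D big_ltn; last by lia.
  have [_] := vdeg_cquo _ x N.-1 irx; rewrite (prednK Npos) /pqdeg; lia.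
pose S := (\sum_(1 <= i < N) pqdeg _ x i)%N.
(* In the constant, l pays for the incomplete last period and S l for the preperiod. *)
exists (pq _ x), N, l, (l + S * l)%N; split=> // [|T]; first exact: is_cf_pq.
rewrite -/D; have [ltTS|leST] := ltnP T S.
  apply: (@leq_trans (S * l * D)); last by rewrite leq_mul2r; apply/orP; right; lia.
  by rewrite -mulnA leq_mul ?(ltnW ltTS) // leq_pmulr.
pose j := ((T - S) %/ D)%N.
have cE : cdeg _ x (N.-1 + j * l)%N = (S + j * D)%N.
  rewrite /cdeg -addSn (prednK Npos) sum_period // => i lei.
  by rewrite /pqdeg per.
have cj : (j * l <= wcount s k T)%N.
  apply: (@leq_trans (wcount s k (cdeg _ x (N.-1 + j * l)%N))).
    by apply: leq_trans (wcount_cdeg s k _ irx); apply: leq_addl.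
  apply: wcount_mono; rewrite cE.
  by have := leq_trunc_div (T - S) D; rewrite -/j; lia.
have ltT : (T <= S + j.+1 * D)%N.
  by have := ltn_ceil (T - S) D0; rewrite -/j; lia.
apply: (@leq_trans ((S + j.+1 * D) * l)); first by rewrite leq_mul2r ltT orbT.
rewrite (mulnDl S) (mulnDl (wcount s k T)) (mulnDl l).
have h1 : (j.+1 * D * l <= wcount s k T * D + l * D)%N.
  by rewrite mulnAC -mulnDl leq_mul2r mulSn addnC leq_add2r cj orbT.
have h2 : (S * l <= S * l * D)%N by rewrite leq_pmulr.
lia.
Qed.

End Counting.

(** * Counting in substitution blocks *)

Section Blocks.
Local Open Scope nat_scope.

Lemma sum_blocks n k (G : nat -> nat) :
  \sum_(0 <= x < n * k) G x = \sum_(0 <= I < n) \sum_(0 <= x < k) G (x + k * I).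
Proof.
rewrite big_nat_mul; apply: eq_bigr => I _.
rewrite -{1}[I * k]add0n big_addn mulSn addnK.
by apply: eq_bigr => x _; rewrite mulnC.
Qed.

Lemma sum_block_le n k I (G : nat -> nat) : I < n ->
  \sum_(0 <= x < k) G (x + k * I) <= \sum_(0 <= x < n * k) G x.
Proof.
by move=> ltIn; rewrite sum_blocks [leqRHS]big_mkord (bigD1 (Ordinal ltIn)) //= leq_addr.
Qed.

Lemma leq_sum_nat n (G H : nat -> nat) : (forall x, x < n -> G x <= H x) ->
  \sum_(0 <= x < n) G x <= \sum_(0 <= x < n) H x.
Proof. by move=> GH; rewrite !big_mkord; apply: leq_sum => i _; apply: GH. Qed.

Lemma sum_div n m (G : nat -> nat) : 0 < m ->
  \sum_(0 <= x < n * m) G (x %/ m) = m * \sum_(0 <= x < n) G x.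
Proof.
move=> m0; rewrite sum_blocks big_distrr; apply: eq_bigr => I _ /=.
rewrite big_nat (eq_bigr (fun=> G I)).
  by rewrite -big_nat sum_nat_const_nat subn0.
by move=> x /andP[_ ltx]; rewrite addnC mulnC divnMDl // divn_small // addn0.
Qed.

(* Row x of the I-th block row meets the strip in columns covered by the blocks
   (I, I) and (I, I+1). *)
Lemma sum_strip (W : nat -> nat -> nat) L Bd T :
  (forall I J, \sum_(0 <= x < L) \sum_(0 <= y < L) W (x + L * I) (y + L * J) <= Bd) ->
  \sum_(0 <= k < L) \sum_(0 <= a < T * L) W a (a + k) <= 2 * T * Bd.
Proof.
move=> blk; rewrite exchange_big_nat /= sum_blocks.
have -> : 2 * T * Bd = \sum_(0 <= I < T) (2 * Bd).
  by rewrite sum_nat_const_nat subn0; lia.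
apply: leq_sum_nat => I _.
apply: (@leq_trans (\sum_(0 <= J < 2) \sum_(0 <= x < L) \sum_(0 <= y < L)
    W (x + L * I) (y + L * (J + I)))); last first.
  rewrite !big_nat_recr //= big_geq // add0n mul2n -addnn.
  by apply: leq_add; apply: blk.
rewrite [leqRHS]exchange_big_nat /=; apply: leq_sum_nat => x ltx.
pose g y := W (x + L * I) (y + L * I).
apply: (@leq_trans (\sum_(0 <= y < 2 * L) g y)); last first.
  rewrite sum_blocks; apply: leq_sum_nat => J _; apply: leq_sum_nat => y _.
  by rewrite /g mulnDr addnA.
rewrite [leqRHS](@big_cat_nat _ _ _ x) /=; [|lia|lia].
rewrite [X in _ <= _ + X](@big_cat_nat _ _ _ (x + L) x) /=; [|lia|lia].
apply: leq_trans (leq_addl _ _); apply: leq_trans (leq_addr _ _).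
rewrite -{3}[x]add0n big_addn addKn; apply: leq_sum_nat => y _.
by rewrite /g (_ : x + L * I + y = y + x + L * I) //; lia.
Qed.

Variables (X : finType) (p : nat) (zero A : X).
Variables (zeta : X -> 'M[X]_p).
Hypothesis p1 : 1 < p.
Hypothesis zetaA : mget (zeta A) zero 0 0 = A.

Local Notation it := (iter_blk zeta zero).
Local Notation zi := (zinf zeta zero A).

(** The recursion peels off the finest level: quotients by p locate the parent letter, remainders
    the place in its block. *)
Lemma iter_blkD K j B x y :
  it (K + j) B x y = it K (it j B (x %/ p ^ K) (y %/ p ^ K)) x y.
Proof.
elim: K x y => [|K IH] x y; first by rewrite expn0 !divn1.
by rewrite addSn /= IH expnS !divnMA.
Qed.

(** Only the K lowest base-p digits of a position are read. *)
Lemma iter_blk_mod K B x y z w : it K B (x + p ^ K * z) (y + p ^ K * w) = it K B x y.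
Proof.
elim: K x y => [//|K IH] x y /=.
have md a b : (a + p ^ K.+1 * b) %% p = a %% p.
  by rewrite expnS -mulnA mulnC addnC modnMDl.
have dv a b : (a + p ^ K.+1 * b) %/ p = a %/ p + p ^ K * b.
  by rewrite expnS -mulnA mulnC addnC divnMDl 1?addnC //; lia.
by rewrite !md !dv IH.
Qed.

Lemma iter_blk00 k : it k A 0 0 = A.
Proof. by elim: k => //= k IH; rewrite div0n mod0n IH. Qed.

Lemma iter_blk_stable k j x y : x < p ^ k -> y < p ^ k -> it (k + j) A x y = it k A x y.
Proof. by move=> ltx lty; rewrite iter_blkD !divn_small // iter_blk00. Qed.

Lemma zinfE k x y : x < p ^ k -> y < p ^ k -> zi x y = it k A x y.
Proof.
move=> ltx lty; rewrite /zinf -(iter_blk_stable k (x + y).+1) // (addnC k).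
rewrite iter_blk_stable //; apply: leq_trans (ltn_expl _ p1); lia.
Qed.

Lemma ltn_blk K j x I : x < p ^ K -> I < p ^ j -> x + p ^ K * I < p ^ (K + j).
Proof.
move=> ltx ltI; rewrite expnD; apply: (@leq_trans (p ^ K * I.+1)).
  by rewrite mulnS ltn_add2r.
by rewrite leq_mul2l ltI orbT.
Qed.

(** Self-similarity of the fixed point: each aligned block is one of finitely many zeta^K(B). *)
Lemma zinf_blk K I J x y : x < p ^ K -> y < p ^ K ->
  zi (x + p ^ K * I) (y + p ^ K * J) = it K (zi I J) x y.
Proof.
move=> ltx lty; pose j := (I + J).+1.
have ltI : I < p ^ j by apply: leq_trans (ltn_expl _ p1); rewrite /j; lia.
have ltJ : J < p ^ j by apply: leq_trans (ltn_expl _ p1); rewrite /j; lia.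
rewrite (zinfE (K + j)) ?ltn_blk // iter_blkD iter_blk_mod.
have dv z B : z < p ^ K -> (z + p ^ K * B) %/ p ^ K = B.
  by move=> ltz; rewrite addnC mulnC divnMDl ?divn_small ?addn0 // expn_gt0 ltnW.
by rewrite !dv.
Qed.

Definition nzcount K B : nat :=
  \sum_(0 <= x < p ^ K) \sum_(0 <= y < p ^ K) (it K B x y != zero).

(** The block of the letter at (I, J) is contained in zeta^(K+j)(A). *)
Lemma nzcount_zinf K j I J : I < p ^ j -> J < p ^ j ->
  nzcount K (zi I J) <= nzcount (K + j) A.
Proof.
move=> ltI ltJ; rewrite /nzcount expnD [p ^ K * _]mulnC.
apply: leq_trans (sum_block_le _ _ _ _ ltI); apply: leq_sum_nat => x ltx.
apply: leq_trans (sum_block_le _ _ _ _ ltJ); apply: leq_sum_nat => y lty.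
by rewrite -(zinf_blk _ _ _ _ _ ltx lty) (zinfE (K + j)) ?ltn_blk.
Qed.

Lemma N0_nzcount k : N0 zeta zero A k + nzcount k A = p ^ (2 * k).
Proof.
rewrite /N0 /nzcount big_mkord; under [X in _ + X]eq_bigr do rewrite big_mkord.
rewrite pair_bigA -sum1_card /= [X in X + _]big_mkcond -big_split /=.
rewrite (eq_bigr (fun=> 1)); first by rewrite sum1_card card_prod !card_ord mul2n -addnn expnD.
move=> xy _; rewrite [_ \in _]asboolb.
by case: (_ == _).
Qed.

Lemma mget_out (T : Type) n (M : 'M[T]_n) d : (forall i j, M i j = d) ->
  forall i j, mget M d i j = d.
Proof. by move=> Md i j; rewrite /mget; case: insubP => // a; case: insubP. Qed.

(** A non-zero entry comes from a non-zero letter, and each letter accounts for m^2 entries. *)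
Lemma xi_zinf_blk m (xi : X -> 'M[bool]_m) K I J : 0 < m ->
  (forall i j, xi zero i j = false) ->
  \sum_(0 <= x < m * p ^ K) \sum_(0 <= y < m * p ^ K)
    xi_zinf zeta xi zero A (x + m * p ^ K * I) (y + m * p ^ K * J)
  <= m ^ 2 * nzcount K (zi I J).
Proof.
move=> m0 xi0.
pose G x y : nat := it K (zi I J) x y != zero.
apply: (@leq_trans (\sum_(0 <= x < p ^ K * m) \sum_(0 <= y < p ^ K * m)
    G (x %/ m) (y %/ m))).
  rewrite [m * _]mulnC; apply: leq_sum_nat => x ltx; apply: leq_sum_nat => y lty.
  have dv z B : (z + p ^ K * m * B) %/ m = z %/ m + p ^ K * B.
    by rewrite mulnAC addnC divnMDl // addnC.
  rewrite /xi_zinf !dv zinf_blk ?ltn_divLR // /G.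
  by case: eqP => [->|_]; [rewrite mget_out|case: (mget _ _ _ _)].
under eq_bigr do rewrite (sum_div _ _ _ m0).
rewrite (sum_div _ _ (fun x => m * \sum_(0 <= y < p ^ K) G x y) m0) -big_distrr /=.
by rewrite mulnA.
Qed.
End Blocks.

(** * Density estimates for letters and diagonals *)

Section Density.
Variable R : realType.

Lemma nzcount_small (X : finType) (p : nat) (zero A : X) (zeta : X -> 'M[X]_p)
  (p1 : (1 < p)%N) (zetaA : mget (zeta A) zero 0 0 = A) :
  (fun k : nat => ((N0 zeta zero A k)%:R / (p ^ (2 * k))%:R : R)) @ \oo --> (1 : R) ->
  forall delta : R, 0 < delta -> exists K0, forall K, (K0 <= K)%N -> forall I J,
    (nzcount _ _ zero zeta K (zinf zeta zero A I J))%:R <= delta * (p ^ (2 * K))%:R.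
Proof.
move=> cvgN delta delta0.
have ppos n : (0 : R) < (p ^ n)%:R by rewrite ltr0n expn_gt0 ltnW.
have small (d : R) : 0 < d -> exists k0, forall k, (k0 <= k)%N ->
    (nzcount _ _ zero zeta k A)%:R <= d * (p ^ (2 * k))%:R.
  move=> d0; move/cvgrPdist_le: cvgN => /(_ d d0) [k0 _ Hk]; exists k0 => k lek.
  have pn := ppos (2 * k)%N.
  rewrite -ler_pdivrMr //; apply: le_trans (Hk k lek); apply: le_trans (ler_norm _).
  rewrite -(N0_nzcount _ _ zero A zeta k) natrD in pn *.
  by rewrite le_eqVlt; apply/orP; left; apply/eqP; field; rewrite gt_eqF.
have loc B : exists K0, forall K, (K0 <= K)%N -> (exists I J, zinf zeta zero A I J = B) ->
    (nzcount _ _ zero zeta K B)%:R <= delta * (p ^ (2 * K))%:R.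
  have [[I [J <-]]|nB] := pselect (exists I J, zinf zeta zero A I J = B); last first.
    by exists 0%N => K _ /nB.
  pose j := (I + J).+1.
  have ltI : (I < p ^ j)%N by apply: leq_trans (ltn_expl _ p1); rewrite /j; lia.
  have ltJ : (J < p ^ j)%N by apply: leq_trans (ltn_expl _ p1); rewrite /j; lia.
  (* The block of B fills the fraction p^(-2j) of zeta^(K+j)(A), so the tolerance is scaled
     accordingly. *)
  have [k0 Hk0] := small (delta / (p ^ (2 * j))%:R) (divr_gt0 delta0 (ppos _)).
  exists k0 => K leK _; apply: le_trans (_ : (nzcount _ _ zero zeta (K + j) A)%:R <= _).
    by rewrite ler_nat; apply: nzcount_zinf.
  apply: (le_trans (Hk0 _ (leq_trans leK (leq_addr _ _)))).
  rewrite mulnDr expnD natrM le_eqVlt; apply/orP; left; apply/eqP.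
  by field; rewrite gt_eqF.
have [N NP] := choice loc.
(* Uniformity in B: the alphabet is finite. *)
exists (\max_B N B) => K leK I J; apply: NP; last by exists I, J.
exact: leq_trans (leq_bigmax _) leK.
Qed.

(* A positive lower density gamma of non-zero entries on the k-th diagonal. *)
Definition dense_diag (F : finFieldType) (s : nat -> F) (gamma : R) (k : nat) : Prop :=
  exists C : nat, forall T, gamma * T%:R <= (wcount _ s k T + C)%:R.

(** Markov's inequality: the lower bounds on the dense diagonals add up to at most the total count.
    The additive constants disappear for large T. *)
Lemma dense_diag_count (F : finFieldType) (s : nat -> F) (gamma : R) (L : nat) (B : R) :
  (0 < L)%N -> 0 < gamma ->
  (forall T, (\sum_(0 <= k < L) wcount _ s k (T * L))%:R <= B * (T * L)%:R) ->
  (\sum_(0 <= k < L) `[< dense_diag F s gamma k >])%:R * gamma <= B.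
Proof.
move=> L0 gamma0 HB; set nb := (\sum_(0 <= k < L) _)%N.
have /choice[C HC] k : exists C : nat, forall T,
    (`[< dense_diag F s gamma k >])%:R * (gamma * T%:R) <= (wcount _ s k T + C)%:R :> R.
  case: asboolP => [[C HC]|_]; first by exists C => T; rewrite mul1r.
  by exists 0%N => T; rewrite mul0r.
pose Ct := (\sum_(0 <= k < L) C k)%N.
have key T : nb%:R * (gamma * (T * L)%:R) <= B * (T * L)%:R + Ct%:R.
  apply: le_trans (lerD (HB T) (lexx _)); rewrite -natrD -big_split /= /nb !natr_sum.
  by rewrite mulr_suml; apply: ler_sum => k _; apply: HC.
rewrite leNgt; apply/negP => ltB; pose e := nb%:R * gamma - B.
have e0 : 0 < e by rewrite subr_gt0.
pose T := Num.Def.archi_bound (Ct%:R / e).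
have ltT : Ct%:R < T%:R * e.
  by rewrite -ltr_pdivrMr //; apply: archi_boundP; rewrite divr_ge0 // ltW.
have : T%:R * e <= (T * L)%:R * e by rewrite ler_pM2r // ler_nat leq_pmulr.
by have := key T; rewrite /e in ltT *; nra.
Qed.

(** With the least K for which m p^K exceeds M, passing from M to m p^K costs at most a factor p. *)
Lemma scale_between (p m K0 M : nat) : (1 < p)%N -> (0 < m)%N -> (m * p ^ K0 <= M)%N ->
  exists K, [/\ (K0 <= K)%N, (M < m * p ^ K)%N & (m * p ^ K <= p * M)%N].
Proof.
move=> p1 m0 leM; have exK : exists K, (M < m * p ^ K)%N.
  by exists M; apply: leq_trans (ltn_expl M p1) _; rewrite leq_pmull.
case: (ex_minnP exK) => K ltK minK.
have ltKK : (K0 < K)%N.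
  by rewrite -(ltn_exp2l _ _ p1) -(ltn_pmul2l m0); apply: leq_ltn_trans ltK.
exists K; split=> //; first exact: ltnW.
case: K ltK minK ltKK => // K _ minK _; rewrite expnS mulnCA leq_mul2l; apply/orP; right.
by rewrite leqNgt; apply/negP => /minK; rewrite ltnn.
Qed.

End Density.

(** * Exceptional k lie on dense diagonals; conclusion *)

Section Assembly.
Variable R : realType.

Lemma card_good_bad (S : nat -> Prop) M :
  (#|[set k : 'I_M.+1 | (0 < (k : nat))%N && `[< S k >]]|
   + \sum_(0 <= k < M.+1) ((0 < k)%N && ~~ `[< S k >]) = M)%N.
Proof.
rewrite -sum1_card big_mkcond [X in (_ + X)%N]big_mkord -big_split /=.
rewrite (eq_bigr (fun i : 'I_M.+1 => (0 < i)%N : nat)).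
  by rewrite big_ord_recl /= add0n sum_nat_const card_ord muln1.
by move=> i _; rewrite [_ \in _]asboolb; case: (0 < i)%N; case: asboolP.
Qed.

(** With S the numerator of e_{k,n}, D - (n+1) l <= S <= (1 - eps) D gives l / D >= eps / (n+1), and
    [cf_wcount] turns this into a density. Using n+1 avoids division by zero at n = 0. *)
Lemma not_Eset_dense (F : finFieldType) (s : nat -> F) (eps : R) n k :
  quad_irrational (theta s) -> 0 < eps -> ~ Eset s eps n k ->
  dense_diag R F s (eps / n.+1%:R) k.
Proof.
move=> qi eps0 nE; have [A [N [l [C [cf mp D0 HT]]]]] := cf_wcount _ s k qi.
exists C => T; have := HT T; move: D0; set D := (\sum_(_ <= i < _) _)%N => D0 leT.
have : eratio R A N l n <= 1 - eps.
  by rewrite leNgt; apply/negP => h; apply: nE; exists A, N, l.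
rewrite /eratio -!natr_sum -/D; set S := (\sum_(_ <= i < _) _)%N.
have DR : (0 : R) < D%:R by rewrite ltr0n.
rewrite ler_pdivrMr // => leS.
have leD : (D <= S + n.+1 * l)%N.
  rewrite /D /S; apply: (@leq_trans (\sum_(N <= i < N + l) (((size (A i)).-1 - n) + n.+1))%N).
    by apply: leq_sum => i _; lia.
  by rewrite big_split /= sum_nat_const_nat; lia.
have leDR : D%:R <= S%:R + n.+1%:R * l%:R :> R by rewrite -natrM -natrD ler_nat.
have leTR : T%:R * l%:R <= (wcount _ s k T + C)%:R * D%:R :> R.
  by rewrite -!natrM ler_nat.
rewrite -(ler_pM2r DR); apply: le_trans leTR.
have n0 : (0 : R) < n.+1%:R by rewrite ltr0n.
rewrite -(ler_pM2r n0).
have -> : eps / n.+1%:R * T%:R * D%:R * n.+1%:R = T%:R * (eps * D%:R).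
  by field; rewrite gt_eqF.
rewrite -mulrA; apply: ler_wpM2l; first exact: ler0n.
by lra.
Qed.

(** A block of side L has at most d L^2 non-zero entries, and 2 T blocks cover the first T L rows of
    the strip. *)
Lemma strip_bound (F : finFieldType) (m : nat) (s : nat -> F)
  (X : finType) (zero A : X) (zeta : X -> 'M[X]_#|F|) (xi : X -> 'M[bool]_m)
  (K : nat) (d : R) (T : nat) : (0 < m)%N -> 0 <= d ->
  mget (zeta A) zero 0 0 = A ->
  (forall i j, xi zero i j = false) ->
  (forall a b : nat, (wall s a b != 0) = xi_zinf zeta xi zero A a b) ->
  (forall I J, (nzcount _ _ zero zeta K (zinf zeta zero A I J))%:R <=
     d * (#|F| ^ (2 * K))%:R) ->
  forall L : nat, L = (m * #|F| ^ K)%N ->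
  (\sum_(0 <= k < L) wcount _ s k (T * L))%:R <= (2 * d * L%:R) * (T * L)%:R :> R.
Proof.
move=> m0 d0 zetaA xi0 profile small L ->.
have p1 : (1 < #|F|)%N := finNzRing_gt1 F.
(* The counts are integers, so they stay below the integer part of the real bound. *)
pose B := Num.truncn (d * (#|F| ^ (2 * K))%:R).
have dp0 : 0 <= d * (#|F| ^ (2 * K))%:R by rewrite mulr_ge0.
have leB : (\sum_(0 <= k < m * #|F| ^ K) wcount _ s k (T * (m * #|F| ^ K))
    <= 2 * T * (m ^ 2 * B))%N.
  rewrite (eq_bigr (fun k => \sum_(0 <= a < T * (m * #|F| ^ K))
    (xi_zinf zeta xi zero A a (a + k)))%N).
    apply: (sum_strip (fun a b => xi_zinf zeta xi zero A a b)) => I J.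
    apply: leq_trans (xi_zinf_blk _ _ _ _ _ p1 zetaA m xi K I J m0 xi0) _.
    by rewrite leq_mul2l truncn_ge_nat // small orbT.
  by move=> k _; apply: eq_bigr => a _; rewrite profile.
have leBR : (2 * T * (m ^ 2 * B))%:R <=
    2 * T%:R * ((m ^ 2)%:R * (d * (#|F| ^ (2 * K))%:R)) :> R.
  rewrite 2!natrM (natrM _ (m ^ 2)); apply: ler_wpM2l; first by rewrite mulr_ge0.
  by apply: ler_wpM2l; [exact: ler0n|have /andP[] := truncn_itv dp0].
apply: (@le_trans _ _ (2 * T * (m ^ 2 * B))%:R); first by rewrite ler_nat.
apply: (le_trans leBR); rewrite mulnC expnM !natrM !natrX le_eqVlt.
by apply/orP; left; apply/eqP; ring.
Qed.

End Assembly.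

Theorem theorem7p11 (F : finFieldType) (R : realType) (m : nat) (s : nat -> F)
  (X : finType) (zero A : X) (zeta : X -> 'M[X]_#|F|) (xi : X -> 'M[bool]_m) :
  (0 < m)%N ->
  quad_irrational (theta s) ->
  mget (zeta A) zero 0 0 = A ->
  (forall i j, xi zero i j = false) ->
  (forall i j, zeta zero i j = zero) ->
  (forall a b : nat, (wall s a b != 0) = xi_zinf zeta xi zero A a b) ->
  (fun k : nat => ((N0 zeta zero A k)%:R / (#|F| ^ (2 * k))%:R : R)) @ \oo --> (1 : R) ->
  forall eps : R, 0 < eps ->
  exists d : nat -> R,
    (\forall n \near \oo, has_density (Eset s eps n) (d n)) /\ d @ \oo --> (1 : R).
Proof.
move=> m0 qi zetaA xi0 _ profile cvgN eps eps0.
exists (fun=> 1); split; last exact: cvg_cst.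
apply: nearW => n; rewrite /has_density; apply/cvgrPdist_le => eta eta0.
have p1 : (1 < #|F|)%N := finNzRing_gt1 F.
have p0 : (0 : R) < #|F|%:R by rewrite ltr0n ltnW.
pose gamma : R := eps / n.+1%:R.
have gamma0 : 0 < gamma by rewrite divr_gt0.
(* Chosen so that 2 delta p M = eta gamma M, since L <= p M. *)
pose delta := eta * gamma / (2 * #|F|%:R).
have delta0 : 0 < delta by rewrite divr_gt0 ?mulr_gt0.
have [K0 HK0] := nzcount_small _ _ _ _ _ _ p1 zetaA cvgN delta delta0.
exists (m * #|F| ^ K0)%N => // M /= leM.
have [K [leK ltM leL]] := scale_between _ _ _ _ p1 m0 leM.
set L := (m * #|F| ^ K)%N in ltM leL.
have M0 : (0 : R) < M%:R.
  by rewrite ltr0n; apply: leq_trans leM; rewrite muln_gt0 m0 expn_gt0 ltnW.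
have L0 : (0 < L)%N by apply: leq_ltn_trans ltM.
have := dense_diag_count _ F s gamma L (2 * delta * L%:R) L0 gamma0
  (fun T => strip_bound R F m s X zero A zeta xi K delta T m0 (ltW delta0) zetaA xi0
     profile (HK0 K leK) L erefl).
set dense := (\sum_(_ <= k < _) _)%N => ledense.
have := card_good_bad (Eset s eps n) M.
rewrite /dens_ratio; set good := #|_|; set bad := (\sum_(_ <= k < _) _)%N => gb.
(* Every exceptional k <= M has a dense diagonal and lies in the strip, as M < L. *)
have lebad : (bad <= dense)%N.
  rewrite /dense (big_cat_nat _ ltM) //=; apply: leq_trans (leq_addr _ _).
  apply: leq_sum => k _; case: asboolP => [_|nE]; first by rewrite andbF.
  rewrite andbT (_ : `[< _ >] = true) ?leq_b1 //; apply/asboolP.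
  exact: not_Eset_dense nE.
have badE : 1 - good%:R / M%:R = bad%:R / M%:R :> R.
  have -> : good%:R = M%:R - bad%:R :> R by rewrite -[in RHS]gb natrD addrK.
  by field; rewrite gt_eqF.
rewrite badE ger0_norm ?divr_ge0 // ler_pdivrMr //.
rewrite -(ler_pM2r gamma0); apply: (@le_trans _ _ (dense%:R * gamma)).
  by rewrite ler_pM2r // ler_nat.
apply: (le_trans ledense); apply: (@le_trans _ _ (2 * delta * (#|F|%:R * M%:R))).
  by rewrite -natrM ler_wpM2l ?ler_nat // mulr_ge0 // ltW.
rewrite le_eqVlt /delta; apply/orP; left; apply/eqP.
by field; rewrite gt_eqF.
Qed.
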